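(* Let $G$ be a divisible design graph with parameters $(v,k,\lambda_1,\lambda_2,m,n)$ and $k-2\in\{\lambda_1,\lambda_2\}$. Then one of the following statements holds: 1. $G$ has parameters $(14,4,2,0,2,7)$ and it is isomorphic to the non-incidence graph of points and lines of the Fano plane; 2. $G$ has parameters $(14,3,1,0,2,7)$ and it is isomorphic to the incidence graph of points and lines of the Fano plane; 3. $G$ has parameters $(8,4,2,0,2,4)$ and it is isomorphic to the $4\times 2$-grid.
   Context: All graphs are finite, undirected, without loops and multiple edges. A $k$-regular graph on $v$ vertices is a divisible design graph with parameters $(v,k,\lambda_1,\lambda_2,m,n)$ if its vertex set can be partitioned into $m$ classes of size $n$ such that two distinct vertices from the same class have exactly $\lambda_1$ common neighbors and two vertices from different classes have exactly $\lambda_2$ common neighbors. The incidence (respectively non-incidence) graph of points and lines of the Fano plane is the bipartite graph on its 7 points and 7 lines in which a point is adjacent to a line iff the point lies (respectively does not lie) on the line. The $4\times 2$-grid is the graph with vertex set $\{1,2,3,4\}\times\{1,2\}$ in which two distinct vertices are adjacent iff they agree in exactly one coordinate.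
   Formalization: The English is false as printed (C_4, C_6, disjoint Heawood copies, n = 1 or m = 1). Added: G is connected, m > 1, n > 1, and k-2 is the larger of λ1, λ2. In case 3 the parameters are corrected to (8,4,0,2,4,2), those of the 4×2-grid. *)

(* Defs.v *)
From mathcomp Require Import all_boot.

Set Implicit Arguments.
Unset Strict Implicit.
Unset Printing Implicit Defensive.

Record graph := Graph {
  vertex :> finType;
  adj : rel vertex;
  adj_sym : symmetric adj;
  adj_irr : irreflexive adj }.

Definition nbrs (G : graph) (x : G) : {set G} := [set y | adj x y].

Definition regular (G : graph) (k : nat) := forall x : G, #|nbrs x| = k.

Definition connected_graph (G : graph) :=
  forall x y : G, connect (@adj G) x y.

Definition isomorphic (G H : graph) :=
  exists2 f : G -> H, bijective f & forall x y, adj (f x) (f y) = adj x y.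

(* No properness is built in: m = 1, n = 1 and l1 = l2 are all allowed (with
   n = 1 the value of l1 is unconstrained, with m = 1 that of l2). *)
Definition divisible_design_graph (G : graph) (v k l1 l2 m n : nat) :=
  [/\ #|G| = v, regular G k &
      exists P : {set {set G}},
        [/\ partition P [set: G], #|P| = m,
            forall B, B \in P -> #|B| = n,
            forall B x y, B \in P -> x \in B -> y \in B -> x != y ->
              #|nbrs x :&: nbrs y| = l1
          & forall B C x y, B \in P -> C \in P -> B != C ->
              x \in B -> y \in C -> #|nbrs x :&: nbrs y| = l2]].

(* The Fano plane as the development of the difference set {0, 1, 3}: its
   points are the residues mod 7, and its l-th line is {l, l + 1, l + 3}. *)
Definition fano_incident (p l : 'I_7) : bool :=
  val p \in [seq (l + d) %% 7 | d <- [:: 0; 1; 3]].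

Lemma fano_two_points (p q : 'I_7) : p != q ->
  exists! l : 'I_7, fano_incident p l && fano_incident q l.
Proof.
move=> npq.
have: has (fun l => (fano_incident p l && fano_incident q l) &&
  all (fun l' => (fano_incident p l' && fano_incident q l') ==> (l' == l))
    [seq inord i | i <- iota 0 7]) [seq inord i : 'I_7 | i <- iota 0 7].
  rewrite /= /fano_incident -!val_eqE /= !inordK //.
  by move: npq; case: p q => [[|[|[|[|[|[|[|?]]]]]]] ?]
    [[|[|[|[|[|[|[|?]]]]]]] ?].
case/hasP => l _ /andP[pql /allP uniq_l]; exists l; split=> // l' pql'.
apply/esym/eqP/(implyP (uniq_l l' _)) => //.
by apply/mapP; exists (val l'); rewrite ?mem_iota ?ltn_ord ?inord_val.
Qed.

(* The bipartite graph of a relation between points (left summand) and lines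
   (right summand). *)
Definition bip_adj (P L : finType) (I : P -> L -> bool) : rel (P + L)%type :=
  fun x y => match x, y with
  | inl p, inr l | inr l, inl p => I p l
  | _, _ => false
  end.

Lemma bip_adj_sym (P L : finType) (I : P -> L -> bool) :
  symmetric (bip_adj I).
Proof. by move=> [?|?] [?|?]. Qed.

Lemma bip_adj_irr (P L : finType) (I : P -> L -> bool) :
  irreflexive (bip_adj I).
Proof. by case. Qed.

Definition bip_graph (P L : finType) (I : P -> L -> bool) : graph :=
  Graph (bip_adj_sym I) (bip_adj_irr I).

Definition fano_incidence_graph : graph := bip_graph fano_incident.

Definition fano_nonincidence_graph : graph :=
  bip_graph (fun p l => ~~ fano_incident p l).

Definition grid_adj (a b : nat) : rel ('I_a * 'I_b)%type :=
  fun x y => (x.1 == y.1) (+) (x.2 == y.2).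

Lemma grid_adj_sym a b : symmetric (@grid_adj a b).
Proof. by move=> x y; rewrite /grid_adj (eq_sym x.1) (eq_sym x.2). Qed.

Lemma grid_adj_irr a b : irreflexive (@grid_adj a b).
Proof. by move=> x; rewrite /grid_adj !eqxx. Qed.

Definition grid (a b : nat) : graph :=
  Graph (@grid_adj_sym a b) (@grid_adj_irr a b).

(* Main.v *)
(* Suppose l1 <> l2. The square of the adjacency matrix is a combination of the
   identity, the all-one matrix and the indicator of the classes, so the latter
   commutes with the adjacency matrix: the class partition is equitable, with a
   symmetric quotient matrix R of row sum k, and R^2 has diagonal entries
   k + (n-1) l1 and off-diagonal entries n l2.

   If l2 = k-2, two rows of R are at squared distance 2 (2 - (n-1)(l2 - l1)),
   hence (n-1)(l2 - l1) <= 2, and only the grid survives.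

   If l1 = k-2, then sum_j R_ij (n - R_ij) = 2 (n-1), where a nonzero term is at
   least n-1. Either one term is nonzero, which forces n = 7 and R_ij = 3 or 4,
   or two are, with entries 1 or n-1; in the latter case k is 0, 2 or -2 mod n
   while k^2 = 2 mod n, so n = 2. For n = 7, R^2 modulo 49 shows that the pairs
   of classes with R_ij = 3 or 4 are connected components, so that the graph
   comes from a 2-(7,3,1) design or its complement. For n = 2, the entries 1 of
   R form a disjoint union of 4-cycles on the classes, so 4 divides m; but
   (k-1)^2 + 1 = 2 l2 (m-1), and -1 is not a square modulo m-1 = 3 mod 4. *)

Require Import Defs.
From mathcomp Require Import all_boot.
From mathcomp Require Import cyclic zify.

Set Implicit Arguments.
Unset Strict Implicit.
Unset Printing Implicit Defensive.

(** * Arithmetic of the parameters *)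

(** The last hypothesis amounts to [(n - 1) * (l2 - l1) <= 2], where both factors are positive. *)
Lemma dist_arith n l1 l2 : 1 < n -> l1 < l2 ->
    n * l2 <= l2 + 2 + n.-1 * l1 ->
  [\/ n = 2 /\ l2 = l1 + 1, n = 2 /\ l2 = l1 + 2 | n = 3 /\ l2 = l1 + 1].
Proof.
case: n => [|[|e]] // _ /subnKC <-; move: (l2 - _) => d /= le_dist.
have : e.+1 * d.+1 <= 2 by lia.
case: e d {le_dist} => [|[|e]] [|[|d]] // _.
- by constructor 1; lia.
- by constructor 2; lia.
by constructor 3; lia.
Qed.

(** This is [R_count] for [n = 2], [l2 = l1 + 2] and a quotient matrix of ones, so that [m = k]. It
    reduces to [l * (l + 4) = 0]. *)
Lemma count_arith_const2 k l : k = l + 4 ->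
  k ^ 2 = k + 1 * l + k.-1 * (2 * (l + 2)) -> l = 0.
Proof. by move=> -> ; rewrite -mulnn addnS /=; nia. Qed.

(** This is [R_count] for [n = 3], [l2 = l1 + 1] and a quotient matrix with all entries 2.
    Substituting [l = 2 * m - 3] leaves [m * (m - 3) = 0], and [m] is positive. *)
Lemma count_arith_const3 k l m : k = m * 2 -> k = l + 3 ->
  k ^ 2 = k + 2 * l + m.-1 * (3 * (l + 1)) -> m = 3.
Proof.
case: m => [|m] -> lE; rewrite -mulnn /=; first by lia.
have -> : l = 2 * m - 1 by lia.
by case: m {lE} => [|m] //; rewrite mulnS; nia.
Qed.

(** This is [R_count] for [n = 2] and [l2 = l1 + 1]. It reads [l ^ 2 + 4 * l + 6 = 2 * (m - 1) * (l
    + 1)], and the left side is 3 modulo [l + 1], so [l + 1] divides 3. *)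
Lemma count_arith_dist2 k l m : 0 < m -> k = l + 3 ->
  k ^ 2 = k + 1 * l + m.-1 * (2 * (l + 1)) -> m = 4 /\ (l = 0 \/ l = 2).
Proof.
case: m => // m _ -> /=; rewrite -mulnn => countE.
have l_dvd : l.+1 %| 3.
  have -> : 3 = l.+1 * (2 * m) - l.+1 * (l + 3) by lia.
  by rewrite dvdn_sub ?dvdn_mulr.
case: l l_dvd countE (dvdn_leq (isT : 0 < 3) l_dvd) => [|[|[|l]]] //= _ countE _.
  by split; [lia | left].
by split; [lia | right].
Qed.

(** The equation becomes [(l + 1) * (l + 2) = (v - 1) * l], so [l] divides 2. This serves the case
    [l1 = l2], where [v = m * n] is composite. *)
Lemma count_arith_equal k l v : k = l + 2 -> k ^ 2 = k + v.-1 * l -> v = 7.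
Proof.
move=> -> countE; have l_dvd : l %| 2.
  have -> : 2 = v.-1 * l - l * (l + 3) by lia.
  by apply: dvdn_sub; [apply: dvdn_mull | apply: dvdn_mulr].
by case: l l_dvd countE (dvdn_leq (isT : 0 < 2) l_dvd) => [|[|[|l]]] //=; lia.
Qed.

Lemma mul_neq7 m n : 1 < m -> 1 < n -> m * n <> 7.
Proof. by case: m => [|[|[|[|m]]]] // _; nia. Qed.

Lemma exists_notin (T : finType) (A : {pred T}) :
  #|A| < #|T| -> exists x, x \notin A.
Proof.
by rewrite -(cardC A) -[X in X < _]addn0 ltn_add2l => /card_gt0P[x]; exists x.
Qed.

Lemma mul_sub_ge n a : 0 < a < n -> n.-1 <= a * (n - a).
Proof. by case/andP=> a_gt0 /subnKC <-; move: (n - _) => b; nia. Qed.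

(** With [b = n - a] the equation is [(a - 1) * (b - 1) = 0]. *)
Lemma mul_sub_eq_pred n a : 0 < a < n -> a * (n - a) = n.-1 -> a = 1 \/ a = n.-1.
Proof.
case/andP; case: a => // a _ /subnKC <-; move: (n - _) => b.
rewrite addSn subSS addSnnS addKn /=; case: a b => [|a] [|b]; rewrite ?addn1; lia.
Qed.

(** With [b = n - a] the equation is [(a - 2) * (b - 2) = 2]. *)
Lemma mul_sub_eq_double n a : 0 < a < n -> a * (n - a) = 2 * n.-1 ->
  n = 7 /\ (a = 3 \/ a = 4).
Proof.
case/andP; case: a => // a _ /subnKC <-; move: (n - _) => b.
rewrite addSn subSS addSnnS addKn /= => abE.
case: a b abE => [|[|a]] [|[|b]] abE; try lia.
have : a.+1 * b.+1 = 2 by lia.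
case: a b {abE} => [|[|a]] [|[|b]]; lia.
Qed.

Lemma mul_sub_eq0 n a : a <= n -> a * (n - a) = 0 -> a = 0 \/ a = n.
Proof. by move=> an /eqP; rewrite muln_eq0 subn_eq0 => /orP[] /eqP; lia. Qed.

(** Modulo [n], [k] is 0, 2 or -2, so [k ^ 2] is 0 or 4; as it is also 2, [n] divides 2 in either
    case. *)
Lemma sqr_mod_pm1 n k a b t s : 0 < n ->
    a = 1 \/ a = n.-1 -> b = 1 \/ b = n.-1 ->
    k = a + b + n * t -> k ^ 2 = 2 + n * s ->
  n %| 2.
Proof.
have dvd2 u v : 2 + n * u = n * v -> n %| 2.
  move=> E; have := dvdn_mulr v (dvdnn n).
  by rewrite -E dvdn_addl // dvdn_mulr.
case: n dvd2 => // n dvd2 _; rewrite -mulnn /=.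
case=> -> [] -> kE; rewrite {2}kE => k2E.
- by apply: (dvd2 (k * t + 2 * t) s); move: k2E kE; lia.
- by apply: (dvd2 s (k * t.+1)); move: k2E; lia.
- by apply: (dvd2 s (k * t.+1)); move: k2E; lia.
by apply: (dvd2 (k * (t + 2)) (s + 2 * (t + 2))); move: k2E kE; nia.
Qed.

Lemma card_two (T : finType) (x y : T) :
  x != y -> (forall z, z = x \/ z = y) -> #|T| = 2.
Proof.
move=> nxy xy; rewrite -cardsT (_ : [set: T] = [set x; y]) ?cards2 ?nxy //.
by apply/setP => z; rewrite !inE; case: (xy z) => ->; rewrite eqxx ?orbT.
Qed.

(** * Non-squareness of -1 modulo numbers congruent to 3 modulo 4 *)

(** Induction on [d]: if the least prime factor is not 3 modulo 4, the cofactor must be. *)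
Lemma prime_dvd_mod4_eq3 d : d %% 4 = 3 ->
  exists p, [/\ prime p, p %% 4 = 3 & p %| d].
Proof.
elim/ltn_ind: d => d IHd d3; have d_gt1 : 1 < d by case: d d3 {IHd} => [|[]].
have p_pr := pdiv_prime d_gt1; have p_d := pdiv_dvd d.
set p := pdiv d in p_pr p_d; have p_gt1 := prime_gt1 p_pr.
have [p3 | p3] := eqVneq (p %% 4) 3; first by exists p.
have dE := divnK p_d; set q := d %/ p in dE.
have q3 : q %% 4 = 3.
  have : (q %% 4) * (p %% 4) = 3 %[mod 4] by rewrite modnMm dE d3.
  move: p3 (ltn_pmod q (isT : 0 < 4)) (ltn_pmod p (isT : 0 < 4)).
  by case: (q %% 4) => [|[|[|[|?]]]]; case: (p %% 4) => [|[|[|[|?]]]].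
have q_lt : q < d by nia.
by have [r [r_pr r3 rq]] := IHd q q_lt q3; exists r; split=> //; rewrite -dE dvdn_mulr.
Qed.

(** For a prime [p] as in [prime_dvd_mod4_eq3], raising [x ^ 2 = -1] to the odd power [(p - 1) / 2]
    gives -1, while Fermat's theorem gives 1; so [p] would divide 2. *)
Lemma dvd_sqr_add1_mod4 d x : d %| x ^ 2 + 1 -> d %% 4 <> 3.
Proof.
move=> dx /prime_dvd_mod4_eq3[p [p_pr p3 pd]].
have px : p %| x ^ 2 + 1 := dvdn_trans pd dx.
have p_gt1 := prime_gt1 p_pr.
have cop : coprime x p.
  rewrite coprime_sym prime_coprime //; apply/negP => p_x.
  have : p %| 1 by rewrite -(dvdn_addr _ (dvdn_mull x p_x)) mulnn.
  by rewrite dvdn1; lia.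
have := Euler_exp_totient cop; rewrite totient_prime //.
have -> : p.-1 = 2 * (2 * (p %/ 4) + 1) by lia.
rewrite expnM => /eqP; set y := x ^ 2 in px *.
(* [y + 1] divides [y ^ r + 1] for odd [r]; the induction adds 2 to the exponent. *)
have odd_pow s : p %| y ^ (2 * s + 1) + 1.
  elim: s => [|s IHs]; first by rewrite expn1.
  have -> : y ^ (2 * s.+1 + 1) + 1 =
      y ^ (2 * s + 1) * (y - 1) * (y + 1) + (y ^ (2 * s + 1) + 1).
    have -> : 2 * s.+1 + 1 = 2 * s + 1 + 2 by lia.
    rewrite expnD; have [y0 | y_gt0] := posnP y. by rewrite y0 !addn1 !exp0n.
    by rewrite -mulnn -(prednK y_gt0) subn1 /=; move: (_ ^ _) => a; nia.
  by rewrite dvdn_add // dvdn_mull.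
move: (odd_pow (p %/ 4)); set z := y ^ _ => pz /eqP z1.
have : p %| 1 + 1 by rewrite /dvdn -modnDml -z1 modnDml.
rewrite dvdn_prime2 // => /eqP p2; by rewrite p2 in p3.
Qed.

(** * Uniqueness of the Fano plane *)

Section FanoUniqueness.

Variables (T : finType) (e : rel T) (A B : {set T}).
Hypothesis card_A : #|A| = 7.
Hypothesis line_card : forall z, z \in B -> #|[set x in A | e x z]| = 3.
Hypothesis join_card : forall x y, x \in A -> y \in A -> x != y ->
  #|[set z in B | e x z && e y z]| = 1.
Hypothesis meet_card : forall z w, z \in B -> w \in B -> z != w ->
  #|[set x in A | e x z && e x w]| = 1.

(** A line is handled through a list of its points. Incidence is compared on [A] only, since [T]
    holds points and lines alike and [e] is unrestricted elsewhere. *)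
Definition is_line (z : T) (s : seq T) :=
  z \in B /\ {in A, forall x, e x z = (x \in s)}.

Lemma is_line_eq z s t : s =i t -> is_line z s -> is_line z t.
Proof. by move=> st [zB zs]; split=> // x xA; rewrite zs // st. Qed.

Lemma is_line_through x y : x \in A -> y \in A -> x != y ->
  exists z t, [/\ is_line z [:: x; y; t], t \in A, x != t & y != t].
Proof.
move=> xA yA nxy.
have /card_gt0P[z] : 0 < #|[set z in B | e x z && e y z]| by rewrite join_card.
rewrite inE => /and3P[zB xz yz].
have /eqP : #|[set x in A | e x z]| = 3 := line_card zB.
rewrite (cardsD1 x) (cardsD1 y) !inE [y == x]eq_sym nxy xA yA xz yz !add1n !eqSS.
case/cards1P => t tE; have : t \in [set t] by rewrite set11.
rewrite -tE !inE => /and4P[nty ntx tA tz].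
exists z, t; split; rewrite // 1?eq_sym //; split=> // u uA.
have /setP/(_ u) := tE; rewrite !inE uA /= => uE.
case: (eqVneq u x) uE => [->|_] //=; case: (eqVneq u y) => [->|_] //=.
Qed.

Lemma is_line_two x y z w s t : is_line z s -> is_line w t ->
    x \in A -> y \in A -> x != y ->
    x \in s -> y \in s -> x \in t -> y \in t ->
  {in A, s =i t}.
Proof.
move=> [zB zs] [wB wt] xA yA nxy xs ys xt yt u uA.
have [zw | nzw] := eqVneq z w; first by rewrite -zs // -wt // zw.
suff : 1 < #|[set x in A | e x z && e x w]| by rewrite meet_card.
apply/card_gt1P; exists x, y; split=> //; rewrite inE ?xA ?yA.
  by rewrite zs // wt // xs.
by rewrite zs // wt // ys.
Qed.

Lemma is_line_meet z w s t : is_line z s -> is_line w t -> z != w ->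
  exists x, [/\ x \in A, x \in s & x \in t].
Proof.
move=> [zB zs] [wB wt] nzw.
have /card_gt0P[x] : 0 < #|[set x in A | e x z && e x w]| by rewrite meet_card.
by rewrite inE => /and3P[xA xz xw]; exists x; rewrite -zs // -wt.
Qed.

(** The line through [x'] and [y'] must meet the line [x y z]. Meeting it in [x] would put [y'] on
    [lx], meeting it in [y] would put [x'] on [ly]; hence it passes through [z]. *)
Lemma is_line_opposite x y z d x' y' l lx ly :
    {subset [:: x; y; z; d; x'; y'] <= A} -> uniq [:: x; y; z; d; x'; y'] ->
    is_line l [:: x; y; z] -> is_line lx [:: x; d; x'] ->
    is_line ly [:: y; d; y'] ->
  exists w, is_line w [:: x'; y'; z].
Proof.
move=> sA U Ll Lx Ly.
have in_s p : p < 6 -> nth x [:: x; y; z; d; x'; y'] p \in A.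
  by move=> p6; apply/sA/mem_nth.
have xA := in_s 0 isT; have yA := in_s 1 isT; have dA := in_s 3 isT.
have x'A := in_s 4 isT; have y'A := in_s 5 isT; rewrite /= in xA yA dA x'A y'A.
have ne p q := @nth_uniq _ x [:: x; y; z; d; x'; y'] p q.
have neE p q p6 q6 := ne p q p6 q6 U.
have nx'y' : x' != y' := negbT (neE 4 5 isT isT).
have nxx' : x != x' := negbT (neE 0 4 isT isT).
have nyy' : y != y' := negbT (neE 1 5 isT isT).
have ny'x : (y' == x) = false := neE 5 0 isT isT.
have ny'd : (y' == d) = false := neE 5 3 isT isT.
have ny'x' : (y' == x') = false := neE 5 4 isT isT.
have nx'y : (x' == y) = false := neE 4 1 isT isT.
have nx'd : (x' == d) = false := neE 4 3 isT isT.
have nx'z : (x' == z) = false := neE 4 2 isT isT.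
have nzx' : (z == x') = false := neE 2 4 isT isT.
have nzy' : (z == y') = false := neE 2 5 isT isT.
have [w [t [Lw tA _ _]]] := is_line_through x'A y'A nx'y'.
have nwl : w != l.
  apply/eqP => wl; case: Lw Ll => [_ /(_ x' x'A)]; rewrite wl => Lw [_ /(_ x' x'A)].
  by rewrite Lw !inE eqxx nx'y nx'z [x' == x]eq_sym (negPf nxx').
have [u [uA uw ul]] := is_line_meet Lw Ll nwl.
exists w; move: ul; rewrite !inE => /or3P[] /eqP uE; rewrite uE in uw.
- have := is_line_two Lx Lw xA x'A nxx' (mem_head _ _)
    (mem_last x [:: d; x']) uw (mem_head _ _) y'A.
  by rewrite !inE eqxx orbT ny'x ny'd ny'x'.
- have y'w : y' \in [:: x'; y'; t] by rewrite !inE eqxx orbT.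
  have := is_line_two Ly Lw yA y'A nyy' (mem_head _ _)
    (mem_last y [:: d; y']) uw y'w x'A.
  by rewrite !inE eqxx nx'y nx'd (negPf nx'y').
by move: uw; rewrite !inE nzx' nzy' => /eqP->.
Qed.

(** Start from a line [a b c] and a point [d] off it. The third points [p1], [p2], [p3] of the lines
    joining [d] to [a], [b], [c] complete the point set, and [is_line_opposite] yields the three
    remaining lines. *)
Lemma fano_unique : exists pt ln : 'I_7 -> T,
  [/\ forall p, pt p \in A, forall l, ln l \in B &
      forall p l, e (pt p) (ln l) = fano_incident p l].
Proof.
have /card_gt1P[a [b [aA bA nab]]] : 1 < #|A| by rewrite card_A.
have [l0 [c [L0 cA nac nbc]]] := is_line_through aA bA nab.
have /subsetPn[d dA] : ~~ (A \subset [set a; b; c]).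
  apply/negP => /subset_leq_card; rewrite card_A -setUA cardsU1 cards2; lia.
rewrite !inE !negb_or -andbA => /and3P[nda ndb ndc].
have third x : x \in [:: a; b; c] -> exists l t,
    [/\ is_line l [:: x; d; t], t \in A, d != t & t \notin [:: a; b; c]].
  move=> x_l0; have xA : x \in A by move: x_l0; rewrite !inE => /or3P[]/eqP->.
  have nxd : x != d.
    by move: x_l0; rewrite !inE => /or3P[]/eqP->; rewrite eq_sym.
  have [l [t [L tA nxt ndt]]] := is_line_through xA dA nxd.
  exists l, t; split=> //; apply/negP => t_l0.
  have := is_line_two L L0 xA tA nxt (mem_head _ _) (mem_last x [:: d; t])
    x_l0 t_l0 dA.
  by rewrite !inE eqxx orbT (negPf nda) (negPf ndb) (negPf ndc).
have [|l1 [p1 [L1 p1A ndp1 p1_l0]]] := third a; first by rewrite !inE eqxx.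
have [|l2 [p2 [L2 p2A ndp2 p2_l0]]] := third b; first by rewrite !inE eqxx orbT.
have [|l3 [p3 [L3 p3A ndp3 p3_l0]]] := third c; first by rewrite !inE eqxx !orbT.
move: (p1_l0) (p2_l0) (p3_l0); rewrite !inE !negb_or.
move=> /and3P[np1a np1b np1c] /and3P[np2a np2b np2c] /and3P[np3a np3b np3c].
(* Two of the lines through [d] sharing a second point would coincide, which would put [x] on the
   line through [y]. *)
have third_neq x y t t' l l' :
    x != y -> x != d -> x != t' -> x \in A -> t \in A -> d != t ->
    is_line l [:: x; d; t] -> is_line l' [:: y; d; t'] -> t != t'.
  move=> nxy nxd nxt' xA tA ndt L L'; apply/eqP => tE; rewrite -tE in L' nxt'.
  have d_l u v : d \in [:: u; d; v] by rewrite !inE eqxx orbT.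
  have := is_line_two L L' dA tA ndt (d_l _ _) (mem_last x [:: d; t])
    (d_l _ _) (mem_last y [:: d; t]) xA.
  by rewrite !inE eqxx (negPf nxy) (negPf nxd) (negPf nxt').
have np12 : p1 != p2 by apply: (third_neq a b _ _ _ _ _ _ _ _ _ _ L1 L2); rewrite // eq_sym.
have np13 : p1 != p3 by apply: (third_neq a c _ _ _ _ _ _ _ _ _ _ L1 L3); rewrite // eq_sym.
have np23 : p2 != p3 by apply: (third_neq b c _ _ _ _ _ _ _ _ _ _ L2 L3); rewrite // eq_sym.
(* The points are ordered so that positions [l], [l + 1], [l + 3] modulo 7 are collinear for every
   [l], matching the difference set {0, 1, 3}; [ls] below lists the lines in the corresponding
   order. *)
pose s := [:: a; b; d; c; p2; p3; p1].
have U : uniq s.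
  rewrite /s /= !inE !negb_or.
  by do !(apply/andP; split); rewrite // eq_sym.
have [||l4 L4] := @is_line_opposite a b c d _ _ _ _ _ _ _ L0 L1 L2.
- by apply/allP; rewrite /= aA bA cA dA ?p1A ?p2A ?p3A.
- rewrite /= !inE !negb_or.
  by do !(apply/andP; split); rewrite // eq_sym.
have [|||l5 L5] := @is_line_opposite a c b d _ _ l0 _ _ _ _ _ L1 L3.
- by apply/allP; rewrite /= aA bA cA dA ?p1A ?p2A ?p3A.
- rewrite /= !inE !negb_or.
  by do !(apply/andP; split); rewrite // eq_sym. 
- by apply: is_line_eq L0 => u; rewrite !inE; do !case: eqP.
have [|||l6 L6] := @is_line_opposite b c a d _ _ l0 _ _ _ _ _ L2 L3.
- by apply/allP; rewrite /= aA bA cA dA ?p1A ?p2A ?p3A.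
- rewrite /= !inE !negb_or.
  by do !(apply/andP; split); rewrite // eq_sym. 
- by apply: is_line_eq L0 => u; rewrite !inE; do !case: eqP.
pose ls := [:: l0; l2; l3; l4; l6; l5; l1].
have sA i : i < 7 -> nth a s i \in A.
  move=> i7; suff : {subset s <= A} by apply; exact: mem_nth.
  by apply/allP; rewrite /= aA bA cA dA p1A p2A p3A.
have lsE l : l < 7 -> is_line (nth a ls l) [seq nth a s ((l + d) %% 7) | d <- [:: 0; 1; 3]].
  case: l => [|[|[|[|[|[|[|//]]]]]]] _ /=.
  - exact: L0.
  - apply: is_line_eq L2 => u; by rewrite !inE; do !case: eqP.
  - apply: is_line_eq L3 => u; by rewrite !inE; do !case: eqP.
  - apply: is_line_eq L4 => u; by rewrite !inE; do !case: eqP.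
  - apply: is_line_eq L6 => u; by rewrite !inE; do !case: eqP.
  - apply: is_line_eq L5 => u; by rewrite !inE; do !case: eqP.
  - apply: is_line_eq L1 => u; by rewrite !inE; do !case: eqP.
exists (fun p => nth a s p), (fun l => nth a ls l); split=> [p | l | p l].
- exact: sA.
- by have [] := lsE l (ltn_ord l).
have [_ ->] := lsE l (ltn_ord l); last exact: sA.
by rewrite /fano_incident !inE !nth_uniq ?ltn_mod.
Qed.

End FanoUniqueness.

(** * Recognition of bipartite graphs, in particular those of the Fano plane *)

Ltac exists_I7 := first
  [ by exists (@Ordinal 7 0 isT) | by exists (@Ordinal 7 1 isT)
  | by exists (@Ordinal 7 2 isT) | by exists (@Ordinal 7 3 isT)
  | by exists (@Ordinal 7 4 isT) | by exists (@Ordinal 7 5 isT)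
  | by exists (@Ordinal 7 6 isT) ].

(** Any labelling that respects incidence is therefore injective on points; the next lemma does the
    same for lines. Both are checked by exhausting the pairs and searching for a separating
    element. *)
Lemma fano_incident_inj (p q : 'I_7) :
  (forall l, fano_incident p l = fano_incident q l) -> p = q.
Proof.
move=> pq; apply/eqP/idPn => npq.
suff [l /eqP[]] : exists l, fano_incident p l != fano_incident q l by apply: pq.
by case: p q {pq} npq => [[|[|[|[|[|[|[|?]]]]]]] ?]
  [[|[|[|[|[|[|[|?]]]]]]] ?] // _; exists_I7.
Qed.

Lemma fano_incident_inj_line (l m : 'I_7) :
  (forall p, fano_incident p l = fano_incident p m) -> l = m.
Proof.
move=> lm; apply/eqP/idPn => nlm.
suff [p /eqP[]] : exists p, fano_incident p l != fano_incident p m by apply: lm.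
by case: l m {lm} nlm => [[|[|[|[|[|[|[|?]]]]]]] ?]
  [[|[|[|[|[|[|[|?]]]]]]] ?] // _; exists_I7.
Qed.

(** The labellings glue to an injection from [P + L] into [G], bijective by cardinality; the
    isomorphism is its inverse. *)
Lemma isomorphic_bip (G : graph) (P L : finType) (inc : P -> L -> bool)
    (pt : P -> G) (ln : L -> G) :
    injective pt -> injective ln -> (forall p l, pt p != ln l) ->
    #|G| = #|P| + #|L| ->
    (forall p l, adj (pt p) (ln l) = inc p l) ->
    (forall p q, ~~ adj (pt p) (pt q)) -> (forall l l', ~~ adj (ln l) (ln l')) ->
  isomorphic G (bip_graph inc).
Proof.
move=> pt_inj ln_inj pt_ln cardG incE adj_pt adj_ln.
pose f (u : P + L) : G := match u with inl p => pt p | inr l => ln l end.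
have f_inj : injective f.
  move=> [p | l] [q | l'] /= /eqP; first by move/eqP/pt_inj->.
  - by rewrite (negPf (pt_ln _ _)).
  - by rewrite eq_sym (negPf (pt_ln _ _)).
  by move/eqP/ln_inj->.
have [|g fK gK] := inj_card_bij f_inj; first by rewrite card_sum cardG.
exists g; first by exists f.
move=> x y; rewrite -{2}(gK x) -{2}(gK y).
case: (g x) (g y) => [p | l] [q | l'] /=.
- by rewrite (negPf (adj_pt _ _)).
- by rewrite incE.
- by rewrite adj_sym incE.
by rewrite (negPf (adj_ln _ _)).
Qed.

(** * Counting neighbors inside a vertex set *)

Lemma card_nbrs_setI (G : graph) (x : G) (S : {set G}) :
  #|nbrs x :&: S| = \sum_(y in S) adj x y.
Proof.
rewrite -sum1_card big_mkcond [RHS]big_mkcond; apply: eq_bigr => y _.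
by rewrite !inE; case: (adj x y); case: (y \in S).
Qed.

(** Ordering the vertices by [enum_rank], every edge inside [S] is counted once from its lower end
    and once from its upper end. *)
Lemma handshake (G : graph) (S : {set G}) :
  ~~ odd (\sum_(x in S) #|nbrs x :&: S|).
Proof.
set lt := fun x y : G => enum_rank x < enum_rank y.
under eq_bigr => x _ do rewrite card_nbrs_setI.
have splitE x y : adj x y = lt x y && adj x y + lt y x && adj x y :> nat.
  have [-> | nxy] := eqVneq x y; first by rewrite adj_irr !andbF.
  rewrite /lt; case: ltngtP => //=; rewrite ?addn0 // => /ord_inj/enum_rank_inj.
  by move/eqP; rewrite (negPf nxy).
under eq_bigr => x _ do (under eq_bigr => y _ do rewrite splitE; rewrite big_split).
rewrite big_split /= [X in _ + X]exchange_big /=.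
under [X in _ + X]eq_bigr => x _ do under eq_bigr => y _ do rewrite adj_sym.
by rewrite addnn odd_double.
Qed.

(** Inclusion-exclusion for the two neighborhoods in [S]: their union avoids both [x] and [y]. *)
Lemma nonadjacent_bound (G : graph) (S : {set G}) (x y : G) :
    x \in S -> y \in S -> x != y -> ~~ adj x y ->
  #|nbrs x :&: S| + #|nbrs y :&: S| + 2 <= #|nbrs x :&: nbrs y :&: S| + #|S|.
Proof.
move=> xS yS nxy nadj.
rewrite -cardsUI -setIIl -setIUl -addnA addnC -addnA leq_add2l.
have <- : #|[set x; y]| = 2 by rewrite cards2 nxy.
rewrite addnC -cardsUI.
have -> : (nbrs x :|: nbrs y) :&: S :&: [set x; y] = set0.
  apply/setP => z; rewrite !inE; apply/negbTE/negP => /andP[/andP[+ _]].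
  by move=> /[swap] /orP[] /eqP->; rewrite adj_irr ?orbF ?[adj y x]adj_sym (negPf nadj).
rewrite cards0 addn0; apply: subset_leq_card; apply/subsetP => z.
by rewrite !inE => /orP[/andP[]//|/orP[]/eqP->].
Qed.

(** * The quotient matrix *)

Section QuotientMatrix.

Variables (G : graph) (I : finType) (c : G -> I) (k n l1 l2 : nat).
Hypothesis G_reg : regular G k.
Hypothesis card_class : forall i, #|[set x | c x == i]| = n.
Hypothesis common : forall x y, x != y ->
  #|nbrs x :&: nbrs y| = if c x == c y then l1 else l2.

Definition deg_in (x : G) (i : I) := #|[set y in nbrs x | c y == i]|.

Lemma deg_inE x i : deg_in x i = \sum_(y in nbrs x) (c y == i).
Proof.
rewrite /deg_in -sum1dep_card big_mkcondr /=.
by apply: eq_bigr => y _; case: (c y == i).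
Qed.

Lemma sum_by_class (S : {set G}) (F : I -> nat) :
  \sum_(y in S) F (c y) = \sum_i #|[set y in S | c y == i]| * F i.
Proof.
rewrite (partition_big c xpredT) //=; apply: eq_bigr => i _.
by rewrite -sum_nat_cond_const; apply: eq_bigr => y /andP[_ /eqP->].
Qed.

Lemma card_by_class (S : {set G}) : #|S| = \sum_i #|[set y in S | c y == i]|.
Proof.
rewrite -sum1_card (sum_by_class S (fun=> 1)).
by apply: eq_bigr => i _; rewrite muln1.
Qed.

(** With [A] the adjacency matrix, [K] the indicator of the classes, [Id] the identity and [J] the
    all-one matrix, [A ^ 2 = k Id + l1 (K - Id) + l2 (J - K)]; this is an entry of its product with
    [A]. The negative terms are moved to the left to stay within natural numbers. *)
Lemma sum_common x y :
  \sum_(z in nbrs y) #|nbrs x :&: nbrs z| + adj y x * l1 + l2 * deg_in y (c x)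
  = adj y x * k + l1 * deg_in y (c x) + l2 * k.
Proof.
have <- : \sum_(z in nbrs y) (z == x) = adj y x.
  have [ayx | /negPf nayx] := boolP (adj y x).
    rewrite (bigD1 x) ?inE //= eqxx big1 // => z /andP[_ /negPf->] //.
  rewrite big1 // => z; rewrite inE; case: eqP => // ->.
  by rewrite nayx.
have -> : l2 * k = \sum_(z in nbrs y) l2 by rewrite sum_nat_const G_reg mulnC.
rewrite deg_inE !big_distrr !big_distrl -!big_split; apply: eq_bigr => z _ /=.
have [->|nzx] := eqVneq z x; first by rewrite setIid G_reg eqxx !muln1 !mul1n; lia.
have nxz : x != z by rewrite eq_sym.
by rewrite (common nxz) (eq_sym (c x)); case: ifP => _; lia.
Qed.

Lemma sum_common_sym (x y : G) :
  \sum_(z in nbrs y) #|nbrs x :&: nbrs z| =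
  \sum_(z in nbrs x) #|nbrs y :&: nbrs z|.
Proof.
under eq_bigr => z _ do rewrite setIC card_nbrs_setI.
under [RHS]eq_bigr => z _ do rewrite setIC card_nbrs_setI.
rewrite exchange_big /=.
by under eq_bigr => z _ do under eq_bigr => w _ do rewrite adj_sym.
Qed.

(* The numbers of 3-walks from x to y and from y to x agree, i.e. the square
   of the adjacency matrix commutes with the adjacency matrix. *)
Lemma deg_in_sym x y : l1 != l2 -> deg_in x (c y) = deg_in y (c x).
Proof.
move=> /eqP l12; have := sum_common x y; have := sum_common y x.
rewrite sum_common_sym (adj_sym y); nia.
Qed.

(** For [y] in class [i], [deg_in_sym] turns [deg_in x i] into [deg_in y (c x)], which depends on
    [x] only through its class. So [R] may be read off from one representative per class. *)
Lemma quotient_matrix : 0 < n -> l1 != l2 ->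
  exists R : I -> I -> nat,
    (forall x i, deg_in x i = R (c x) i) /\ (forall i j, R i j = R j i).
Proof.
move=> n_gt0 l12.
have c_surj i : exists x, c x == i.
  have: 0 < #|[set x | c x == i]| by rewrite card_class.
  by case/card_gt0P => x; rewrite inE; exists x.
pose rep i := xchoose (c_surj i).
have repK i : c (rep i) = i by apply/eqP/(xchooseP (c_surj i)).
have deg_rep x y : deg_in x (c y) = deg_in (rep (c x)) (c y).
  by rewrite deg_in_sym // -(repK (c x)) deg_in_sym // repK.
exists (fun i j => deg_in (rep i) j); split=> [x i | i j].
  by rewrite -(repK i) deg_rep repK.
by rewrite -{1}(repK j) deg_in_sym // repK.
Qed.

Variable R : I -> I -> nat.
Hypothesis n_gt0 : 0 < n.
Hypothesis RE : forall x i, deg_in x i = R (c x) i.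
Hypothesis R_sym : forall i j, R i j = R j i.

Lemma class_inhabited i : exists x, c x = i.
Proof.
have: 0 < #|[set x | c x == i]| by rewrite card_class.
by case/card_gt0P => x; rewrite inE => /eqP; exists x.
Qed.

Lemma R_row_sum i : \sum_j R i j = k.
Proof.
have [x <-] := class_inhabited i; rewrite -(G_reg x) card_by_class.
by apply: eq_bigr => j _; rewrite -RE.
Qed.

Lemma R_le i j : R i j <= n.
Proof.
have [x <-] := class_inhabited i; rewrite -RE -(card_class j).
by apply: subset_leq_card; apply/subsetP => y; rewrite !inE => /andP[].
Qed.

Lemma R_diag_lt i : R i i < n.
Proof.
have [x cx] := class_inhabited i; rewrite -{1}cx -RE -(card_class i).
apply: proper_card; apply/properP; split.
  by apply/subsetP => y; rewrite !inE => /andP[].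
by exists x; rewrite !inE ?cx ?eqxx // adj_irr.
Qed.

(** Walks of length 2 from a vertex [x] of class [i] into class [j] are counted by the class of the
    middle vertex and by the end vertex. When [i = j], the end vertex [x] itself contributes [k]. *)
Lemma R_square i j :
  \sum_p R i p * R p j = if i == j then k + n.-1 * l1 else n * l2.
Proof.
have [x cx] := class_inhabited i.
have -> : \sum_p R i p * R p j = \sum_(y | c y == j) #|nbrs x :&: nbrs y|.
  rewrite -cx; under eq_bigr => p _ do rewrite -RE.
  rewrite -(sum_by_class (nbrs x) (fun p => R p j)).
  under eq_bigr => z _ do rewrite -RE deg_inE.
  under [RHS]eq_bigr => y _ do rewrite setIC card_nbrs_setI.
  rewrite exchange_big /=; apply: eq_bigr => z; rewrite inE => xz.
  rewrite [RHS]big_mkcond [LHS]big_mkcond /=; apply: eq_bigr => y _.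
  by rewrite inE [adj z y]adj_sym; case: (adj y z); case: (c y == j).
case: eqP => [<- | /eqP nij].
  rewrite (bigD1 x) ?cx //= setIid G_reg; congr (_ + _).
  rewrite (eq_bigr (fun=> l1)); last first.
    by move=> y /andP[/eqP cy nyx]; rewrite common 1?eq_sym // cx cy eqxx.
  rewrite sum_nat_cond_const; congr (_ * _).
  rewrite -(card_class i) (cardsD1 x [set x | c x == i]) inE cx eqxx /=.
  by apply: eq_card => y; rewrite !inE andbC.
rewrite (eq_bigr (fun=> l2)) ?sum_nat_cond_const ?card_class //.
move=> y /eqP cy; rewrite common ?cx ?cy ?(negPf nij) //.
by apply/eqP => xy; rewrite -cx -cy xy eqxx in nij.
Qed.

(** This sums row [i] of the square of [R], whose row sums are [k * k]. *)
Lemma R_count : I -> k ^ 2 = k + n.-1 * l1 + #|I|.-1 * (n * l2).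
Proof.
move=> i; rewrite -mulnn -{2}(R_row_sum i) big_distrr /=.
transitivity (\sum_j \sum_p R i p * R p j).
  rewrite exchange_big /=; apply: eq_bigr => p _.
  by rewrite -big_distrr /= R_row_sum mulnC.
under eq_bigr => j _ do rewrite R_square.
rewrite (bigD1 i) //= eqxx; congr (_ + _).
rewrite (eq_bigr (fun=> n * l2)) => [|j /negPf]; last by rewrite eq_sym => ->.
rewrite sum_nat_cond_const; congr (_ * _).
have := cardsC1 i; rewrite -cardsE => <-.
by apply: eq_card => j; rewrite !inE.
Qed.

Lemma nbrs_in_card1 x y z : R (c x) (c y) = 1 -> c y = c z ->
  adj x y -> adj x z -> y = z.
Proof.
move=> R1 cyz axy axz; apply/eqP/idPn => nyz.
suff : 1 < R (c x) (c y) by rewrite R1.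
rewrite -RE; apply/card_gt1P; exists y, z; split=> //; rewrite !inE.
- by rewrite axy eqxx.
by rewrite axz cyz eqxx.
Qed.

Lemma R_adj_gt0 x y : adj x y -> 0 < R (c x) (c y).
Proof.
by move=> axy; rewrite -RE; apply/card_gt0P; exists y; rewrite !inE axy eqxx.
Qed.

Lemma R_gt0_adj x i : 0 < R (c x) i -> exists2 y, adj x y & c y = i.
Proof. by rewrite -RE => /card_gt0P[y]; rewrite !inE => /andP[? /eqP]; exists y. Qed.

Lemma R_full_adj x y : R (c x) (c y) = n -> adj x y.
Proof.
rewrite -RE -(card_class (c y)) => deg_full.
suff /setP/(_ y): [set z in nbrs x | c z == c y] = [set z | c z == c y].
  by rewrite !inE eqxx andbT => ->.
apply/eqP; rewrite eqEcard -/(deg_in x (c y)) deg_full leqnn andbT.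
by apply/subsetP => z; rewrite !inE => /andP[].
Qed.

Lemma card_G : #|G| = #|I| * n.
Proof.
rewrite -cardsT card_by_class.
under eq_bigr => i _.
  rewrite (_ : [set y in [set: G] | c y == i] = [set y | c y == i]) ?card_class.
    over.
  by apply/setP => y; rewrite !inE.
by rewrite sum_nat_const.
Qed.

Lemma class_pair x y z :
  n = 2 -> c y = c x -> c z = c x -> y != x -> z != x -> y = z.
Proof.
move=> n2 cy cz nyx nzx; have := card_class (c x).
rewrite (cardsD1 x) inE eqxx n2 => -[/eqP/cards1P[w wE]].
have /setP/(_ y) := wE; have /setP/(_ z) := wE.
by rewrite !inE nyx nzx cy cz eqxx => /esym/eqP-> /esym/eqP.
Qed.

Lemma sum_enumeration (s : seq I) (F : I -> nat) : uniq s -> size s = #|I| ->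
  \sum_i F i = \sum_(i <- s) F i.
Proof.
move=> s_uniq s_size; rewrite [RHS]big_uniq //=; apply: eq_bigl => i.
have s_card : #|s| = #|I| by rewrite (card_uniqP s_uniq).
by rewrite (subset_cardP s_card (subset_predT _)).
Qed.

(** Every vertex has exactly one neighbor in each class, its own included. The grid coordinates are
    the class of a vertex and its membership in a 4-clique [K] meeting every class once. *)
Lemma isomorphic_grid : n = 2 -> l1 = 0 -> l2 = 2 -> k = 4 -> #|I| = 4 ->
  (forall i j, R i j = 1) -> isomorphic G (grid 4 2).
Proof.
move=> n2 l10 l22 k4 I4 R1.
have nbr x i : exists2 y, adj x y & c y = i by apply: R_gt0_adj; rewrite R1.
have nbr_eq x y z : adj x y -> adj x z -> c y = c z -> y = z.
  by move=> axy axz cyz; apply: (nbrs_in_card1 (R1 _ _) cyz axy axz).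
have [x0 _] : exists x : G, true.
  have /card_gt0P[i _] : 0 < #|I| by rewrite I4.
  by have [x _] := class_inhabited i; exists x.
(* The clique through [x0] consists of [x0] and its neighbors outside its class. *)
pose K y := (y == x0) || adj x0 y && (c y != c x0).
have Kx0 : K x0 by rewrite /K eqxx.
have K_rep i : exists2 t, K t & c t = i.
  have [<- | ni] := eqVneq (c x0) i; first by exists x0.
  by have [t at_ ct] := nbr x0 i; exists t; rewrite // /K at_ ct [i == _]eq_sym ni orbT.
have K_inj y z : K y -> K z -> c y = c z -> y = z.
  move=> /orP[/eqP-> | /andP[ay ny]] /orP[/eqP-> | /andP[az nz]] // cyz.
  - by rewrite cyz eqxx in nz.
  - by rewrite cyz eqxx in ny.
  exact: nbr_eq ay az cyz.
have K_clique y z : K y -> K z -> y != z -> adj y z.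
  move=> /orP[/eqP-> | /andP[ay ny]] /orP[/eqP-> | /andP[az nz]] nyz.
  - by rewrite eqxx in nyz.
  - by [].
  - by rewrite adj_sym.
  (* The four neighbors of [x0] include [y] and its class mate [x1]; neither is adjacent to [y]. As
     [x0] and [y] have [l2 = 2] common neighbors, these are the remaining two, one of which is
     [z]. *)
  have [x1 a1 c1] := nbr x0 (c x0).
  have nyx0 : x0 != y by apply: contraNneq ny => <-.
  have nx1y : x1 != y by apply: contraNneq ny => <-; rewrite c1.
  have nx1 : ~~ adj y x1.
    apply/negP => ayx1; have ayx0 : adj y x0 by rewrite adj_sym.
    by have := nbr_eq _ _ _ ayx1 ayx0 c1 => x10; rewrite x10 adj_irr in a1.
  have := G_reg x0; rewrite k4 (cardsD1 y) (cardsD1 x1) !inE ay a1 nx1y !add1n.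
  case=> cardS; suff : z \in nbrs x0 :&: nbrs y by rewrite !inE => /andP[].
  suff /eqP-> : nbrs x0 :&: nbrs y == (nbrs x0 :\ y) :\ x1.
    rewrite !inE az [z == y]eq_sym nyz !andbT.
    by apply: contraNneq nz => ->; rewrite c1.
  rewrite eqEcard cardS (common nyx0) eq_sym (negPf ny) l22 leqnn andbT.
  apply/subsetP => w; rewrite !inE => /andP[-> aw]; rewrite andbT.
  apply/andP; split; first by apply: contraNneq nx1 => <-.
  by apply: contraTneq aw => ->; rewrite adj_irr.
have adjE x y : adj x y = (c x == c y) (+) (K x == K y).
  have [-> | nxy] := eqVneq x y; first by rewrite adj_irr !eqxx.
  have [cxy | ncxy] := eqVneq (c x) (c y).
    have [w aw cw] := nbr x (c x).
    have nwx : w != x by apply: contraTneq aw => ->; rewrite adj_irr.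
    have nyx : y != x by rewrite eq_sym.
    rewrite (class_pair n2 (esym cxy) cw nyx nwx) aw.
    have [t Kt ct] := K_rep (c x).
    have [tx | ntx] := eqVneq t x.
      have Kx : K x by rewrite -tx.
      by rewrite Kx; case Kw: (K w) => //; case/eqP: nwx; apply: K_inj.
    have <- := class_pair n2 ct cw ntx nwx; rewrite Kt; case Kx: (K x) => //.
    by case/eqP: ntx; apply: K_inj.
  (* A vertex [u] of [K] already has its unique neighbor in the class of [v], namely the member of
     [K] there. *)
  have KnK u v : K u -> ~~ K v -> c u != c v -> ~~ adj u v.
    move=> Ku nKv nuv; have [t Kt ct] := K_rep (c v).
    have nut : u != t by apply: contraNneq nuv => ->; rewrite ct.
    apply/negP => auv; have := nbr_eq _ _ _ (K_clique _ _ Ku Kt nut) auv ct.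
    by move=> tv; rewrite -tv Kt in nKv.
  case Kx: (K x); case Ky: (K y) => /=.
  - exact: K_clique.
  - by apply/negbTE/KnK; rewrite ?Ky.
  - by rewrite adj_sym; apply/negbTE/KnK; rewrite ?Kx // eq_sym.
  (* With [x] and [y] both off [K], the neighbor [w] of [x] in the class of [y] is either [y] or the
     member of [K]; [KnK] excludes the latter. *)
  have [t Kt ct] := K_rep (c x); have [w aw cw] := nbr x (c y).
  have [-> // | nyw] := eqVneq y w.
  have [s Ks cs] := K_rep (c y).
  have nys : s != y by apply: contraFneq Ky => <-.
  have nwy : w != y by rewrite eq_sym.
  have sw := class_pair n2 cs cw nys nwy.
  have nsx : c s != c x by rewrite cs eq_sym.
  by have := KnK _ _ Ks (negbT Kx) nsx; rewrite sw adj_sym aw.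
pose f x : grid 4 2 := (cast_ord I4 (enum_rank (c x)), if K x then ord0 else ord_max).
exists f; last first.
  move=> x y; rewrite adjE /= /grid_adj /= (inj_eq (@cast_ord_inj _ _ _)).
  by rewrite (inj_eq (@enum_rank_inj _)); case: (K x); case: (K y).
apply: inj_card_bij; last by rewrite card_G n2 I4 card_prod !card_ord.
move=> x y fxy; have cxy := enum_rank_inj (cast_ord_inj (congr1 fst fxy)).
have Kxy : K x = K y by case: fxy; case: (K x); case: (K y).
apply/eqP/idPn => nxy; have := adjE x y; rewrite cxy Kxy !eqxx /=.
have [t Kt ct] := K_rep (c x); case Ky: (K y).
  by rewrite Ky in Kxy; case/eqP: nxy; apply: K_inj.
have ntx : t != x by apply: contraTneq Kt => ->; rewrite Kxy Ky.
have nty : t != y by apply: contraTneq Kt => ->; rewrite Ky.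
have nyx : y != x by rewrite eq_sym.
by rewrite (class_pair n2 ct (esym cxy) ntx nyx) eqxx in nty.
Qed.

(** * The case l2 = k - 2 *)

(* Half the squared distance of rows i and j is the difference of the sides. *)
Lemma R_row_dist i j : i != j ->
  n * l2 <= k + n.-1 * l1 ?= iff [forall p, R i p == R j p].
Proof.
move=> nij; have [le2 eq2] :=
  @leqif_sum _ xpredT _ _ _ (fun p _ => nat_Cauchy (R i p) (R j p)).
have lhsE : \sum_p 2 * (R i p * R j p) = 2 * (n * l2).
  rewrite -big_distrr /=; congr (_ * _); under eq_bigr => p _ do rewrite [R j p]R_sym.
  by rewrite R_square (negPf nij).
have rhsE : \sum_p (R i p ^ 2 + R j p ^ 2) = 2 * (k + n.-1 * l1).
  have sq a : \sum_p R a p ^ 2 = k + n.-1 * l1.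
    under eq_bigr => p _ do rewrite -mulnn {2}R_sym.
    by rewrite R_square eqxx.
  by rewrite big_split /= !sq mul2n addnn.
by rewrite lhsE rhsE leq_pmul2l // eqn_pmul2l // in le2 eq2.
Qed.

(** Equality in [R_row_dist] makes all rows equal; by symmetry all columns are equal too. *)
Lemma R_constant : n * l2 = k + n.-1 * l1 -> forall i j i' j', R i j = R i' j'.
Proof.
move=> eq_dist i j i' j'.
have rowE a b p : R a p = R b p.
  have [-> // | nab] := eqVneq a b.
  have [_] := R_row_dist nab; rewrite eq_dist eqxx => /esym/forallP/(_ p)/eqP //.
by rewrite (rowE i i') R_sym (rowE j j') R_sym.
Qed.

(** Such a graph would contain a triangle meeting three classes. With entries at most 1 and unit
    diagonal, the rows of these classes are exhausted, so the fourth class has diagonal entry 3. *)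
Lemma no_octic_cubic : n = 2 -> k = 3 -> l1 = 0 -> l2 = 1 -> #|I| <> 4.
Proof.
move=> n2 k3 l10 l21 I4.
(* If a class had no inner edge, the three neighbors of [x] would lie in other classes and each have
   [l2 = 1] common neighbor with [x], inducing a 1-regular graph on three vertices. *)
have R_diag i : R i i = 1.
  have := R_diag_lt i; rewrite n2; have [x cx] := class_inhabited i.
  suff : 0 < R i i by lia.
  rewrite lt0n; apply/eqP => Rii0; have := handshake (nbrs x).
  rewrite (eq_bigr (fun=> 1)) ?sum_nat_const ?G_reg ?k3 // => y yx.
  have axy : adj x y by rewrite inE in yx.
  have ncyx : c y != c x.
    by apply/eqP => cyx; have := R_adj_gt0 axy; rewrite cyx cx Rii0.
  by rewrite common ?(negPf ncyx) //; apply: contraNneq ncyx => ->.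
(* The squares in a row sum to [k + l1 = 3], which leaves no room for an entry 2. *)
have R_le1 i j : R i j <= 1.
  have := R_square i i; rewrite eqxx k3 l10 (bigD1 j) //= [R j i]R_sym muln0.
  by move: (\sum_(p | _) _); case: (R i j) => [|[|a]] r; lia.
have nbr_eq x y z : adj x y -> adj x z -> c y = c z -> y = z.
  move=> axy axz cyz; apply: nbrs_in_card1 cyz (axy) axz.
  by apply/eqP; rewrite eqn_leq R_le1 (R_adj_gt0 axy).
have R_adj1 x y : adj x y -> R (c x) (c y) = 1.
  by move=> axy; apply/eqP; rewrite eqn_leq R_le1 (R_adj_gt0 axy).
have [i _] : exists i : I, true by have /card_gt0P[i _] : 0 < #|I|; [rewrite I4|exists i].
have [x cx] := class_inhabited i.
have [y yx ncxy] : exists2 y, y \in nbrs x & c x != c y.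
  case: (boolP [exists y in nbrs x, c x != c y]) => [/exists_inP // |].
  rewrite negb_exists_in => /forall_inP cN; exfalso.
  suff : deg_in x (c x) = 3 by rewrite RE R_diag.
  rewrite -k3 -(G_reg x); apply: eq_card => y; rewrite inE.
  by apply: andb_idr => /cN; rewrite negbK eq_sym.
have nxy : x != y by apply: contraNneq ncxy => ->.
have axy : adj x y by rewrite inE in yx.
have ayx : adj y x by rewrite adj_sym.
have /card_gt0P[z] : 0 < #|nbrs x :&: nbrs y|.
  by rewrite common // (negPf ncxy) l21.
rewrite !inE => /andP[axz ayz].
have ncxz : c x != c z.
  by apply/eqP => /(nbr_eq _ _ _ ayx ayz) xz; rewrite xz adj_irr in axz.
have ncyz : c y != c z.
  by apply/eqP => /(nbr_eq _ _ _ axy axz) yz; rewrite yz adj_irr in ayz.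
have [j nj] : exists j, j \notin [:: c x; c y; c z].
  by apply: exists_notin; rewrite I4 ltnS card_size.
have rowE a : R a j + (R a (c x) + (R a (c y) + R a (c z))) = 3.
  rewrite -k3 -(R_row_sum a) (@sum_enumeration [:: j; c x; c y; c z]) ?I4 //.
    by rewrite !big_cons big_nil addn0.
  by rewrite cons_uniq nj /= !inE negb_or ncxy ncxz ncyz.
have := rowE j; have := rowE (c x); have := rowE (c y); have := rowE (c z).
rewrite !R_diag ![R (c z) _]R_sym [R (c y) (c x)]R_sym !R_adj1 //.
by rewrite ![R _ j]R_sym; have := R_le1 j; lia.
Qed.

Lemma l2_max_parameters : k = l2 + 2 -> l1 < l2 -> 1 < n -> 1 < #|I| ->
  [/\ n = 2, l1 = 0, l2 = 2, k = 4 & #|I| = 4] /\ (forall i j, R i j = 1).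
Proof.
move=> kE l12 n_gt1 /[dup] m_gt1 /card_gt1P[i [i' [_ _ nii']]].
have := R_count i; have [+ _] := R_row_dist nii'; move=> dist_le count.
have m_gt0 : 0 < #|I| := ltnW m_gt1; have := R_diag_lt i; move=> Rii_lt.
have R_const_k : n * l2 = k + n.-1 * l1 ->
    (forall a b, R a b = R i i) /\ k = #|I| * R i i.
  move=> eq_dist; have R_c a b : R a b = R i i := R_constant eq_dist a b i i.
  by split=> //; rewrite -(R_row_sum i) (eq_bigr (fun=> R i i)) ?sum_nat_const.
rewrite kE in dist_le.
have [[n2 l2E]|[n2 l2E]|[n3 l2E]] := dist_arith n_gt1 l12 dist_le.
- rewrite n2 l2E in count; have kE3 : k = l1 + 3 by lia.
  have [m4 l1_02] := count_arith_dist2 m_gt0 kE3 count.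
  (* What remains besides the cubic graph has [k = 5] on 8 vertices: two nonadjacent vertices would
     share at least 4 neighbors, but [l1 = 2] and [l2 = 3]. *)
  exfalso; case: l1_02 => l1E; first by apply: (no_octic_cubic n2); lia.
  have [x _] := class_inhabited i.
  have [y ny] : exists y, y \notin x |: nbrs x.
    by apply: exists_notin; rewrite card_G m4 n2 cardsU1 G_reg; lia.
  move: ny; rewrite !inE negb_or eq_sym => /andP[nxy nadj].
  have := nonadjacent_bound (in_setT x) (in_setT y) nxy nadj.
  by rewrite !setIT common // !G_reg cardsT card_G m4 n2; case: ifP => _; lia.
- have [|R_c k_mul] := R_const_k; first by rewrite n2 /=; lia.
  have k_gt0 : 0 < k by lia.
  have R1 : R i i = 1.
    by move: Rii_lt k_gt0; rewrite n2 k_mul; case: (R i i) => [|[|]] //; rewrite muln0.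
  rewrite R1 muln1 in k_mul; have kE4 : k = l1 + 4 by lia.
  rewrite n2 l2E -k_mul in count; have l10 := count_arith_const2 kE4 count.
  by split; [split; lia | move=> a b; rewrite R_c].
have [|R_c k_mul] := R_const_k; first by rewrite n3 /=; lia.
have [R1 | R_neq1] := eqVneq (R i i) 1.
  (* Each class would induce a perfect matching on three vertices. *)
  have := handshake [set x | c x == i].
  rewrite (eq_bigr (fun=> 1)); first by rewrite sum_nat_const card_class n3.
  move=> x; rewrite inE => /eqP cx; have <- : deg_in x i = 1 by rewrite RE cx R1.
  by apply: eq_card => y; rewrite !inE.
have R2 : R i i = 2.
  have k_gt0 : 0 < k by lia.
  move: Rii_lt R_neq1 k_gt0; rewrite n3 k_mul; case: (R i i) => [|[|[|]]] //.
  by rewrite muln0.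
rewrite n3 l2E in count; rewrite R2 in k_mul.
have m3 := count_arith_const3 k_mul (_ : k = l1 + 3) count.
(* Now [k = 6] and [l2 = 4] on 9 vertices. As [R i i' = 2 < 3], some [x] and [y] in different
   classes are nonadjacent, and [nonadjacent_bound] would give [6 + 6 + 2 <= 4 + 9]. *)
have [x cx] := class_inhabited i; have [x' cx'] := class_inhabited i'.
have : ~~ [forall y in [set y | c y == i'], adj x y].
  apply/forall_inP => all_adj.
  have : R i i' = 3.
    rewrite -cx -RE -n3 -(card_class i'); apply: eq_card => y; rewrite !inE.
    by apply: andb_idl => cy; rewrite all_adj ?inE.
  by rewrite R_c R2.
rewrite negb_forall_in => /exists_inP[y]; rewrite inE => /eqP cy nadj.
have ncxy : c x != c y by rewrite cx cy.
have nxy : x != y by apply: contraNneq ncxy => ->.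
have := nonadjacent_bound (in_setT x) (in_setT y) nxy nadj.
rewrite !setIT common // (negPf ncxy) !G_reg cardsT card_G; lia.
Qed.

(** * The case l1 = k - 2 *)

(** Row [i] has sum [k] and sum of squares [k + (n - 1) * l1], so the left side is
    [(n - 1) * (k - l1)]. *)
Lemma row_defect i : k = l1 + 2 -> \sum_j R i j * (n - R i j) = 2 * n.-1.
Proof.
move=> kE; have sqE : \sum_j R i j * R i j = k + n.-1 * l1.
  by under eq_bigr => j _ do rewrite {2}R_sym; rewrite R_square eqxx.
have : \sum_j R i j * (n - R i j) + \sum_j R i j * R i j = k * n.
  rewrite -(R_row_sum i) big_distrl -big_split /=; apply: eq_bigr => j _.
  by rewrite -mulnDr subnK ?R_le.
by rewrite sqE kE; case: (n) n_gt0 => // n' _ /=; lia.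
Qed.

(** The alternatives correspond to one or two nonzero terms in [row_defect]; two nonzero terms
    attain the bound [n - 1] of [mul_sub_ge] and use up the whole sum. *)
Lemma row_shape i : k = l1 + 2 -> 1 < n ->
    (n = 7 /\ exists j, (R i j = 3 \/ R i j = 4) /\
                        forall l, l != j -> R i l = 0 \/ R i l = n) \/
    exists p q, [/\ p != q, R i p = 1 \/ R i p = n.-1, R i q = 1 \/ R i q = n.-1
                  & forall l, l != p -> l != q -> R i l = 0 \/ R i l = n].
Proof.
move=> kE n_gt1; have defect := row_defect i kE.
have trivialP l : R i l * (n - R i l) = 0 -> R i l = 0 \/ R i l = n.
  by apply: mul_sub_eq0; apply: R_le.
have nontrivialP l : R i l * (n - R i l) != 0 -> 0 < R i l < n.
  by rewrite muln_eq0 subn_eq0 negb_or -lt0n -ltnNge.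
have [p p_neq0] : exists p, R i p * (n - R i p) != 0.
  apply/existsP; apply: contraTT isT; rewrite negb_exists => /forallP all0.
  have : 2 * n.-1 = 0 by rewrite -defect big1 // => j _; apply/eqP/negPn/all0.
  by lia.
have := mul_sub_ge (nontrivialP p p_neq0); move: defect; rewrite (bigD1 p) //=.
have [rest0 | rest_neq0] := eqVneq (\sum_(l | l != p) R i l * (n - R i l)) 0.
  rewrite rest0 addn0 => pE _; left.
  have [n7 p34] := mul_sub_eq_double (nontrivialP p p_neq0) pE.
  split=> //; exists p; split=> // l nlp; apply: trivialP.
  by move/eqP: rest0; rewrite sum_nat_eq0 => /forall_inP/(_ l nlp)/eqP.
have [q nqp q_neq0] : exists2 q, q != p & R i q * (n - R i q) != 0.
  apply/exists_inP; apply: contraNT rest_neq0; rewrite negb_exists_in => /forall_inP all0.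
  by rewrite sum_nat_eq0; apply/forall_inP => q /all0; rewrite negbK.
rewrite (bigD1 q) //= => defect p_ge; have q_ge := mul_sub_ge (nontrivialP q q_neq0).
right; exists p, q; split; rewrite 1?eq_sym //.
- by apply: mul_sub_eq_pred (nontrivialP p p_neq0) _; lia.
- by apply: mul_sub_eq_pred (nontrivialP q q_neq0) _; lia.
move=> l nlp nlq; apply: trivialP.
have /eqP : \sum_(l | (l != p) && (l != q)) R i l * (n - R i l) = 0 by lia.
by rewrite sum_nat_eq0 => /forall_inP/(_ l); rewrite nlp nlq => /(_ isT)/eqP.
Qed.

Lemma two_nontrivial_n2 i p q : k = l1 + 2 -> 1 < n -> p != q ->
    R i p = 1 \/ R i p = n.-1 -> R i q = 1 \/ R i q = n.-1 ->
    (forall l, l != p -> l != q -> R i l = 0 \/ R i l = n) ->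
  n = 2.
Proof.
move=> kE n_gt1 npq Rp Rq R_triv.
have /dvdnP[t restE] : n %| \sum_(l | (l != p) && (l != q)) R i l.
  by apply: dvdn_sum => l /andP[nlp nlq]; case: (R_triv l nlp nlq) => ->; rewrite ?dvdn0.
have n_dvd2 : n %| 2.
  (* The last witness comes from [R_count], where [k + (n - 1) * l1 = 2 + n * l1]. *)
  apply: (@sqr_mod_pm1 n k _ _ t (l1 + #|I|.-1 * l2) n_gt0 Rp Rq).
    by rewrite -(R_row_sum i) (bigD1 p) //= (bigD1 q) 1?eq_sym //= restE; lia.
  by rewrite (R_count i) kE; case: (n) n_gt0 => // n' _ /=; lia.
by apply/eqP; rewrite eqn_leq n_gt1 andbT dvdn_leq.
Qed.

(* With x ~ x' in class i and y ~ y' in class q, x ~ y, the vertices x, y' have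
   the common neighbors of x, y and moreover x'. *)
Lemma no_loop_pair i q : n = 2 -> i != q -> R i i = 1 -> R q q = 1 -> R i q = 1 ->
  ~ (forall l, l != i -> l != q -> R q l = 0 \/ R q l = n).
Proof.
move=> n2 niq Rii Rqq Riq R_triv; have [x cx] := class_inhabited i.
have nbr y j : R (c y) j = 1 -> exists2 z, adj y z & c z = j.
  by move=> R1; apply: R_gt0_adj; rewrite R1.
have [x' axx' cx'] : exists2 z, adj x z & c z = i by apply: nbr; rewrite cx.
have [y axy cy] : exists2 z, adj x z & c z = q by apply: nbr; rewrite cx.
have [y' ayy' cy'] : exists2 z, adj y z & c z = q by apply: nbr; rewrite cy.
have [x2 ay'x2 cx2] : exists2 z, adj y' z & c z = i.
  by apply: nbr; rewrite cy' R_sym.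
have nyy' : y != y' by apply: contraTneq ayy' => ->; rewrite adj_irr.
have nx'x : x' != x by apply: contraTneq axx' => ->; rewrite adj_irr.
have x2E : x2 = x'.
  apply: (@class_pair x); rewrite ?cx //; apply: contraNneq nyy' => x2x.
  apply/eqP/(@nbrs_in_card1 x); rewrite ?cx ?cy ?cy' //.
  by rewrite adj_sym -x2x.
have nxy : x != y by apply: contraNneq niq => xy; rewrite -cx -cy xy.
have nxy' : x != y' by apply: contraNneq niq => xy; rewrite -cx -cy' xy.
suff : #|nbrs x :&: nbrs y| < #|nbrs x :&: nbrs y'|.
  by rewrite !common // cx cy cy' ltnn.
apply: proper_card; apply/properP; split; last first.
  rewrite x2E in ay'x2; exists x'; rewrite !inE axx' ?ay'x2 //=.
  apply: contra nx'x => ayx'; apply/eqP.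
  by apply: (@nbrs_in_card1 y); rewrite ?cx ?cx' ?cy // 1?R_sym // adj_sym.
apply/subsetP => z; rewrite !inE => /andP[axz ayz]; rewrite axz /=.
have [czi | nczi] := eqVneq (c z) i.
  have zx : z = x.
    by apply: (@nbrs_in_card1 y); rewrite ?cx ?cy ?czi // 1?R_sym // adj_sym.
  by rewrite zx adj_irr in axz.
have [czq | nczq] := eqVneq (c z) q.
  have zy : z = y by apply: (@nbrs_in_card1 x); rewrite ?cx ?cy ?czq.
  by rewrite zy adj_irr in ayz.
(* The class of [z] is joined to class [q] completely or not at all, and [z] is adjacent to [y];
   hence [z] is adjacent to [y'] as well. *)
apply: R_full_adj; rewrite cy'; case: (R_triv _ nczi nczq) => // R0.
by have := R_adj_gt0 ayz; rewrite cy R0.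
Qed.

(** The entries 1 of [R] define a 2-regular graph on the classes, with neighborhoods [O i]. Two of
    these are equal or disjoint and there are no loops, so the components are 4-cycles. *)
Lemma l1_max_n_neq2 : k = l1 + 2 -> 1 < #|I| -> n <> 2.
Proof.
move=> kE m_gt1 n2; have n_gt1 : 1 < n by rewrite n2.
pose O i := [set j | R i j == 1].
have O_sym i j : (j \in O i) = (i \in O j) by rewrite !inE R_sym.
have O_shape i : exists p q, [/\ p != q, O i = [set p; q]
    & forall l, l != p -> l != q -> R i l = 0 \/ R i l = n].
  have [[n7 _] | [p [q [npq Rp Rq R_triv]]]] := row_shape i kE n_gt1.
    by rewrite n2 in n7.
  exists p, q; split=> //; apply/setP => l; rewrite !inE.
  have [-> | nlp] := eqVneq l p; first by apply/eqP; case: Rp; rewrite ?n2.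
  have [-> | nlq] := eqVneq l q; first by apply/eqP; case: Rq; rewrite ?n2.
  by case: (R_triv l nlp nlq) => ->; rewrite ?n2.
have card_O i : #|O i| = 2 by have [p [q [npq -> _]]] := O_shape i; rewrite cards2 npq.
have O_meet i j p : p \in O i -> p \in O j -> O i = O j.
  move=> pi pj; have [-> // | nij] := eqVneq i j.
  suff /eqP card_meet : #|O i :&: O j| == 2.
    have sub_eq (S : {set I}) : O i :&: O j \subset S -> #|S| = 2 -> O i :&: O j = S.
      by move=> sS cS; apply/eqP; rewrite eqEcard sS card_meet cS.
    by rewrite -[LHS](sub_eq _ (subsetIl _ _)) // (sub_eq _ (subsetIr _ _)).
  have meet_gt0 : 0 < #|O i :&: O j| by apply/card_gt0P; exists p; rewrite inE pi.
  have meet_le2 : #|O i :&: O j| <= 2.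
    by rewrite -(card_O i) subset_leq_card ?subsetIl.
  (* Off the diagonal the square of [R] is [2 * l2]; modulo 2 it counts the positions where both
     rows have an entry 1. So the intersection has even size. *)
  have : #|O i :&: O j| + 2 * \sum_l (R i l * R l j)./2 = 2 * l2.
    have := R_square i j; rewrite (negPf nij) n2 => <-.
    rewrite -sum1_card big_mkcond big_distrr -big_split /=; apply: eq_bigr => l _.
    rewrite -[RHS]odd_double_half mul2n; congr (_ + _).
    rewrite !inE oddM [R l j]R_sym.
    have odd_R a : odd (R a l) = (R a l == 1).
      by have := R_le a l; rewrite n2; case: (R a l) => [|[|[|]]].
    by rewrite !odd_R; do 2!case: (_ == 1).
  by move: meet_gt0 meet_le2; lia.
have O_loopless i : i \notin O i.
  apply/negP => ii; have [p [q [npq OiE R_triv]]] := O_shape i.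
  have [r [nir OrE R_triv']] : exists r, [/\ i != r, O i = [set i; r] &
      forall l, l != i -> l != r -> R i l = 0 \/ R i l = n].
    move: ii; rewrite OiE !inE => /orP[] /eqP E; [exists q | exists p]; split=> //.
    - by rewrite E.
    - by rewrite -E.
    - by move=> l nl nl'; apply: R_triv; rewrite -?E.
    - by rewrite E eq_sym.
    - by rewrite -E setUC.
    by move=> l nl nl'; apply: R_triv; rewrite -?E.
  (* A loop at [i] forces one at [r], because [O i] and [O r] share [i]; this is the configuration
     excluded by [no_loop_pair]. *)
  have ri : r \in O i by rewrite OrE !inE eqxx orbT.
  have Oir : O i = O r by apply: (O_meet i r i); rewrite // -O_sym.
  apply: (@no_loop_pair r i) => //; first by rewrite eq_sym.
  - by move: ri; rewrite Oir inE => /eqP.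
  - by move: ii; rewrite inE => /eqP.
  - by move: ri; rewrite O_sym inE => /eqP.
  by move=> l nlr nli; apply: R_triv'.
have O_eq i p l : p \in O i -> (O l == O i) = (l \in O p).
  move=> pi; apply/eqP/idP => [Ol | lp]; first by rewrite O_sym Ol.
  by apply: (O_meet l i p) => //; rewrite -O_sym.
(* [E] relates the members of one 4-cycle: those on the side of [i] have the same [O], those on the
   other side form [O i]. *)
pose E i l := (O l == O i) || (l \in O i).
have E_equiv : {in [set: I] & &, equivalence_rel E}.
  move=> x y z _ _ _; split; first by rewrite /E eqxx.
  case/orP => [/eqP Oxy | yx]; rewrite /E; first by rewrite Oxy.
  by rewrite (O_eq x y) // (O_eq y x) 1?orbC // O_sym.
have dvd4 : 4 %| #|I|.
  rewrite -cardsT (@card_uniform_partition _ 4 _ _ _ (equivalence_partitionP E_equiv)).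
    exact: dvdn_mull.
  move=> _ /imsetP[i _ ->].
  have [p pi] : exists p, p \in O i by apply/card_gt0P; rewrite card_O.
  rewrite -[RHS]/(2 + 2) -{1}(card_O p) -(card_O i) -cardsUI.
  have -> : O p :&: O i = set0.
    apply/setP => l; rewrite in_setI in_set0; apply/negP => /andP[lp li].
    have /eqP Oli : O l == O i by rewrite (O_eq _ p).
    by have := O_loopless l; rewrite Oli li.
  rewrite cards0 addn0; apply: eq_card => l.
  by rewrite in_setU in_set in_setT /E (O_eq _ p).
apply: (@dvd_sqr_add1_mod4 #|I|.-1 k.-1); last by move: m_gt1; lia.
have -> : k.-1 ^ 2 + 1 = #|I|.-1 * (2 * l2); last exact: dvdn_mulr.
have [i _] : exists i : I, i \in I by apply/card_gt0P/ltnW.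
by have := R_count i; rewrite kE n2 -!mulnn addn2 /=; nia.
Qed.

(** Outside class [j], the class mates [x] and [y] have the same neighbors. Hence the [k - l1 = 2]
    neighbors of [x] not shared with [y] all lie in class [j]. *)
Lemma common_in_block x y j : k = l1 + 2 -> c x = c y -> x != y ->
    (forall l, l != j -> R (c x) l = 0 \/ R (c x) l = n) ->
  #|nbrs x :&: nbrs y :&: [set z | c z == j]| + 2 = R (c x) j.
Proof.
move=> kE cxy nxy R_triv; have := common nxy; rewrite cxy eqxx -cxy.
have := R_row_sum (c x); rewrite (card_by_class (_ :&: _)).
rewrite (bigD1 j) //= [in X in _ -> X](bigD1 j) //=.
have -> : [set z in nbrs x :&: nbrs y | c z == j]
        = nbrs x :&: nbrs y :&: [set z | c z == j].
  by apply/setP => z; rewrite !inE.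
have -> : \sum_(l | l != j) #|[set z in nbrs x :&: nbrs y | c z == l]|
        = \sum_(l | l != j) R (c x) l.
  apply: eq_bigr => l nlj; case: (R_triv l nlj) => Rl.
    rewrite Rl; apply/eqP; rewrite cards_eq0; apply/eqP/setP => z; rewrite !inE.
    apply/negP => /andP[/andP[axz _] /eqP cz].
    by have := R_adj_gt0 axz; rewrite cz Rl.
  rewrite Rl -(card_class l); apply: eq_card => z; rewrite !inE.
  apply: andb_idl => /eqP cz; apply/andP; split; apply: R_full_adj.
    by rewrite cz.
  by rewrite -cxy cz.
by rewrite kE; lia.
Qed.

Lemma card_nbrs_class x i : #|nbrs x :&: [set y | c y == i]| = R (c x) i.
Proof. by rewrite -RE; apply: eq_card => y; rewrite !inE. Qed.

(** The two classes become the points and lines of a Fano plane. The [(+)] treats both graphs at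
    once: incidence for [r = 3], non-incidence for [r = 4]. *)
Lemma fano_bipartite i j r :
    n = 7 -> l1 + 2 = k -> i != j -> (forall l, l = i \/ l = j) ->
    R i i = 0 -> R j j = 0 -> R i j = r -> r = 3 \/ r = 4 ->
  isomorphic G (bip_graph (fun p l => (r == 4) (+) fano_incident p l)).
Proof.
move=> n7 kE nij ij Rii Rjj Rij r34.
(* Plane incidence is adjacency for [r = 3] and non-adjacency for [r = 4], so that every line has
   three points. *)
pose e (x y : G) := adj x y == (r == 3).
have meet a b : R a b = r -> R a a = 0 -> (forall l, l = a \/ l = b) ->
  forall x y, x \in [set z | c z == a] -> y \in [set z | c z == a] -> x != y ->
  #|[set z in [set z | c z == b] | e x z && e y z]| = 1.
  move=> Rab Raa ab x y; rewrite !inE => /eqP cx /eqP cy nxy.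
  have cxy : c x = c y by rewrite cx cy.
  have := @common_in_block x y b (esym kE) cxy nxy; rewrite cx Rab.
  have triv l : l != b -> R a l = 0 \/ R a l = n.
    by case: (ab l) => [-> _ | ->]; [left | rewrite eqxx].
  move=> /(_ triv); have := card_nbrs_class x b; have := card_nbrs_class y b.
  rewrite cx cy Rab => dy dx; case: r34 dx dy => rE; rewrite rE => dx dy common_b.
    have <- : #|nbrs x :&: nbrs y :&: [set z | c z == b]| = 1 by lia.
    by apply: eq_card => z; rewrite !inE /e rE !eqb_id andbC.
  (* For [r = 4] the common non-neighbors number [7 - (4 + 4 - 2) = 1]. *)
  have := cardsUI (nbrs x :&: [set z | c z == b]) (nbrs y :&: [set z | c z == b]).
  rewrite -setIIl -setIUl dx dy => cardU.
  have := cardsID (nbrs x :|: nbrs y) [set z | c z == b].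
  rewrite card_class n7 setIC => cardD.
  rewrite (_ : [set z in _ | _] = [set z | c z == b] :\: (nbrs x :|: nbrs y)); first by lia.
  by apply/setP => z; rewrite !inE /e rE /= !eqbF_neg negb_or andbC.
have Rji : R j i = r by rewrite R_sym.
have ji l : l = j \/ l = i by case: (ij l); [right | left].
have line a b : R a b = r -> forall z, z \in [set z | c z == a] ->
    #|[set x in [set x | c x == b] | e x z]| = 3.
  move=> Rab z; rewrite inE => /eqP cz; have := card_nbrs_class z b; rewrite cz Rab.
  have := cardsID (nbrs z) [set z | c z == b]; rewrite setIC card_class n7.
  move=> cardD dz; case: r34 => rE; rewrite rE in dz cardD *.
    by rewrite -dz; apply: eq_card => x; rewrite !inE /e rE adj_sym eqb_id andbC.
  have <- : #|[set z | c z == b] :\: nbrs z| = 3 by lia.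
  by apply: eq_card => x; rewrite !inE /e rE adj_sym eqbF_neg andbC.
have [||||pt [ln [ptA lnB inc]]] :=
    @fano_unique G e [set x | c x == i] [set x | c x == j].
- by rewrite card_class.
- exact: line.
- exact: meet.
- move=> z w zB wB nzw; rewrite -(meet j i Rji Rjj ji z w zB wB nzw).
  by apply: eq_card => x; rewrite !inE /e ![adj x _]adj_sym.
have cpt p : c (pt p) = i by have := ptA p; rewrite inE => /eqP.
have cln l : c (ln l) = j by have := lnB l; rewrite inE => /eqP.
apply: (@isomorphic_bip G _ _ _ pt ln).
- by move=> p q pq; apply: fano_incident_inj => l; rewrite -!inc pq.
- by move=> l m lm; apply: fano_incident_inj_line => p; rewrite -!inc lm.
- by move=> p l; apply: contraNneq nij => /(congr1 c); rewrite cpt cln => ->.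
- by rewrite card_G n7 !card_ord (card_two nij ij).
- by move=> p l; rewrite -inc /e; case: (adj _ _); case: r34 => ->.
- by move=> p q; apply/negP => /R_adj_gt0; rewrite !cpt Rii.
by move=> p q; apply/negP => /R_adj_gt0; rewrite !cln Rjj.
Qed.

Lemma l1_max_parameters : k = l1 + 2 -> 1 < n -> 1 < #|I| -> connected_graph G ->
  exists r, [/\ r = 3 \/ r = 4, n = 7, k = r, l2 = 0 & #|I| = 2] /\
    isomorphic G (bip_graph (fun p l => (r == 4) (+) fano_incident p l)).
Proof.
move=> kE n_gt1 m_gt1 G_conn; have n_neq2 := l1_max_n_neq2 kE m_gt1.
have shape i : n = 7 /\ exists j, (R i j = 3 \/ R i j = 4) /\
    forall l, l != j -> R i l = 0 \/ R i l = 7.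
  case: (row_shape i kE n_gt1) => [[n7 row] | [p [q [npq Rp Rq R_triv]]]].
    by split=> //; move: row; rewrite n7.
  by case: n_neq2; apply: two_nontrivial_n2 Rp Rq R_triv.
have [i0 _] : exists i : I, i \in I by apply/card_gt0P/ltnW.
have n7 : n = 7 by case: (shape i0).
(* All entries of a row but one are multiples of 7, so the exceptional entry, 3 or 4, is [k] modulo
   7 and is the same for every class. *)
pose r := k %% 7.
have partner i : exists j, R i j = r /\ forall l, l != j -> R i l = 0 \/ R i l = 7.
  have [_ [j [Rij R_triv]]] := shape i; exists j; split=> //.
  have rest : 7 %| \sum_(l | l != j) R i l.
    by apply: dvdn_sum => l /R_triv[] ->.
  have := R_row_sum i; rewrite (bigD1 j) //= /r => <-.
  by rewrite -modnDmr (eqP rest) addn0 modn_small //; case: Rij => ->.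
have r34 : r = 3 \/ r = 4.
  have [_ [j [Rij R_triv]]] := shape i0; have [j' [Rij' R_triv']] := partner i0.
  have [E | njj'] := eqVneq j j'; first by rewrite -Rij' -E.
  by case: (R_triv' j njj') => E; case: Rij; rewrite E.
have trivial i j l : R i j = r -> l != j -> R i l = 0 \/ R i l = 7.
  move=> Rij nlj; have [j' [Rij' R_triv]] := partner i.
  have [E | njj'] := eqVneq j j'; first by apply: R_triv; rewrite -E.
  by case: (R_triv j njj') Rij => -> E; case: r34; rewrite -E.
(* A class would induce a 3-regular graph on 7 vertices, against [handshake], or a 4-regular one. In
   the latter, nonadjacent vertices share [4 - 2] neighbors in the class, against
   [nonadjacent_bound]. *)
have loopless i : R i i != r.
  apply/eqP => Rii; have [x cx] := class_inhabited i; case: r34 => rE.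
    have := handshake [set x | c x == i].
    rewrite (eq_bigr (fun=> 3)); first by rewrite sum_nat_const card_class n7.
    by move=> y; rewrite inE card_nbrs_class => /eqP->; rewrite Rii.
  have [y yP] : exists y, y \in ([set y | c y == i] :\ x) :\: nbrs x.
    apply/card_gt0P; have := cardsID (nbrs x) ([set y | c y == i] :\ x).
    have := cardsD1 x [set y | c y == i]; rewrite card_class n7 inE cx eqxx.
    have := subset_leq_card (subsetIr ([set y | c y == i] :\ x) (nbrs x)).
    have := card_nbrs_class x i; rewrite cx Rii rE.
    have : #|([set y | c y == i] :\ x) :&: nbrs x| <= #|nbrs x :&: [set y | c y == i]|.
      by apply/subset_leq_card/subsetP => z; rewrite !inE => /andP[/andP[_ ->] ->].
    by lia.
  move: yP; rewrite !inE => /and3P[nadj nyx /eqP cy].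
  have xC : x \in [set z | c z == i] by rewrite inE cx.
  have yC : y \in [set z | c z == i] by rewrite inE cy.
  have nxy : x != y by rewrite eq_sym.
  have := nonadjacent_bound xC yC nxy nadj; rewrite !card_nbrs_class cx cy Rii card_class.
  have cxy : c x = c y by rewrite cx cy.
  have := @common_in_block x y i kE cxy nxy; rewrite cx Rii n7 rE => /(_ _) common_i.
  have := common_i (fun l nli => trivial i i l Rii nli); lia.
have diag0 i : R i i = 0.
  have [j [Rij _]] := partner i; have nij : i != j.
    by apply: contraNneq (loopless i) => {2}->; rewrite Rij.
  by case: (trivial i j i Rij nij) => // Rii; have := R_diag_lt i; rewrite Rii n7.
(* The entries of the square of R modulo 49 isolate each pair of partners. *)
have isolated i j l : R i j = r -> l != i -> R j l = 0.
  move=> Rij nli; have Rji : R j i = r by rewrite R_sym.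
  have nij : i != j by apply: contraNneq (loopless i) => {2}->; rewrite Rij.
  have [-> // | nlj] := eqVneq l j.
  have dvd49 a b : a = 0 \/ a = 7 -> b = 0 \/ b = 7 -> 49 %| a * b.
    by move=> [] -> [] ->.
  (* The terms at [i] and [j] vanish with the diagonal; in all others both factors are multiples of
     7. *)
  have sq_ij : 49 %| 7 * l2.
    have := R_square i j; rewrite (negPf nij) n7 => <-; apply: dvdn_sum => p _.
    have [-> | npi] := eqVneq p i; first by rewrite diag0.
    have [-> | npj] := eqVneq p j; first by rewrite diag0 muln0.
    apply: dvd49; first exact: trivial npj.
    by rewrite R_sym; apply: trivial npi.
  have [l' [Rll' _]] := partner l; have Rl'l : R l' l = r by rewrite R_sym.
  have nl'j : l' != j.
    apply/eqP => E; rewrite E in Rl'l.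
    by case: (trivial j i l Rji nli) Rl'l => -> E'; case: r34; rewrite -E'.
  have := R_square i l; rewrite eq_sym (negPf nli) n7 => sq_il.
  move: sq_ij; rewrite -sq_il (bigD1 j) //= (bigD1 l') //= addnA dvdn_addl; last first.
    apply: dvdn_sum => p /andP[npj npl']; apply: dvd49; first exact: trivial npj.
    by rewrite R_sym; apply: trivial npl'.
  (* What remains is [r * (R j l + R i l')], with both entries 0 or 7 and [r] equal to 3 or 4. It is
     divisible by 49 only when both entries vanish. *)
  rewrite Rij Rl'l.
  case: (trivial i j l' Rij nl'j) => ->; case: (trivial j i l Rji nli) => ->;
  by case: r34 => ->.
have [j [Rij _]] := partner i0; have Rji : R j i0 = r by rewrite R_sym.
have nij : i0 != j by apply: contraNneq (loopless i0) => {2}->; rewrite Rij.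
(* By [isolated], no edge leaves the union of classes [i0] and [j], so connectedness makes it the
   whole graph. *)
have ij l : l = i0 \/ l = j.
  have [x cx] := class_inhabited i0; have [z <-] := class_inhabited l.
  pose a := [pred y : G | (c y == i0) || (c y == j)].
  have a_closed : closed (@adj G) a.
    apply: (intro_closed (sym_connect_sym (@adj_sym G))) => y y' ayy'.
    have := R_adj_gt0 ayy'; rewrite !inE => + /orP[] /eqP cy; rewrite cy.
      have [-> | nyj] := eqVneq (c y') j; first by rewrite orbT.
      by rewrite (isolated j i0).
    have [-> // | nyi] := eqVneq (c y') i0.
    by rewrite (isolated i0 j).
  have := closed_connect a_closed (G_conn x z); rewrite !inE cx eqxx /=.
  by case/esym/orP => /eqP; [left | right].
exists r; split; last exact: fano_bipartite nij ij _ _ Rij r34.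
split=> //; last exact: card_two nij ij.
- rewrite -(R_row_sum i0) (bigD1 j) //= big1 ?addn0 // => l nlj.
  exact: isolated Rji nlj.
have := R_square i0 j; rewrite (negPf nij) n7 big1 => [|p _]; first by lia.
by case: (ij p) => ->; rewrite diag0 ?muln0.
Qed.

(** * The degenerate case [l1 = l2] *)

(** Counting the walks of length 2 from [x] gives the usual relation between the parameters of a
    symmetric design. *)
Lemma common_count (x : G) : l1 = l2 -> k ^ 2 = k + #|G|.-1 * l1.
Proof.
move=> l12; rewrite -mulnn -{1}(G_reg x) -sum_nat_const.
have -> : \sum_(z in nbrs x) k = \sum_y #|nbrs x :&: nbrs y|.
  under [RHS]eq_bigr => y _ do rewrite setIC card_nbrs_setI.
  rewrite exchange_big /=; apply: eq_bigr => z _.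
  rewrite -(G_reg z) -(setIT (nbrs z)) card_nbrs_setI.
  by apply: eq_big => y; rewrite ?inE // adj_sym.
rewrite (bigD1 x) //= setIid G_reg; congr (_ + _).
rewrite (eq_bigr (fun=> l1)) => [|y nyx].
  by rewrite sum_nat_const cardC1.
by rewrite common 1?eq_sym // -l12 if_same.
Qed.

End QuotientMatrix.

(** The two bounds [k_sub2] and [k_sub2_max] together say that [k - 2] is the larger of [l1] and
    [l2]. Connectedness rules out disjoint copies of the Fano graphs. In the grid the classes are
    the four pairs agreeing in the first coordinate: such a pair has no common neighbor and any
    other pair has two, whence [(8, 4, 0, 2, 4, 2)]. *)
Theorem theorem3 (G : graph) (v k l1 l2 m n : nat)
  (G_ddg : divisible_design_graph G v k l1 l2 m n)
  (G_conn : connected_graph G)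
  (m_gt1 : 1 < m) (n_gt1 : 1 < n)
  (k_sub2 : k = l1 + 2 \/ k = l2 + 2)
  (k_sub2_max : maxn l1 l2 + 2 <= k) :
  [\/ (v, k, l1, l2, m, n) = (14, 4, 2, 0, 2, 7) /\
        isomorphic G fano_nonincidence_graph,
      (v, k, l1, l2, m, n) = (14, 3, 1, 0, 2, 7) /\
        isomorphic G fano_incidence_graph
    | (v, k, l1, l2, m, n) = (8, 4, 0, 2, 4, 2) /\
        isomorphic G (grid 4 2)].
Proof.
case: G_ddg => vE G_reg [P [/and3P[/eqP coverP trivP _] card_P card_B same diff]].
(* The blocks themselves index the classes, with [pblock] as the class map. *)
pose I := {B : {set G} | B \in P}.
have in_cover x : x \in cover P by rewrite coverP.
have pblockP x : pblock P x \in P by rewrite pblock_mem.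
pose c x : I := Sub (pblock P x) (pblockP x).
have in_c x : x \in val (c x) by rewrite /= mem_pblock.
have cE x i : (c x == i) = (x \in val i).
  apply/eqP/idP => [<- // | xi]; apply/val_inj.
  exact: def_pblock trivP (valP i) xi.
have card_class i : #|[set x | c x == i]| = n.
  rewrite -(card_B _ (valP i)); apply: eq_card => x; by rewrite inE cE.
have card_I : #|{: I}| = m by rewrite card_sig -card_P; apply: eq_card.
have common x y : x != y ->
    #|nbrs x :&: nbrs y| = if c x == c y then l1 else l2.
  move=> nxy; case: eqP => [cxy | /eqP ncxy].
    by apply: (same (val (c x))); rewrite ?(valP (c x)) // cxy.
  by apply: (diff (val (c x)) (val (c y))); rewrite ?(valP (c _)).
have v_mul : v = m * n by rewrite -vE (card_G card_class) card_I.
have I_gt1 : 1 < #|{: I}| by rewrite card_I.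
have n_gt0 := ltnW n_gt1.
(* If [l1 = l2], counting forces [v = 7], which is not a product of two factors greater than 1. *)
have [l12 | l12] := eqVneq l1 l2.
  have [x _] : exists x, x \in G by apply/card_gt0P; rewrite vE v_mul; nia.
  have := common_count G_reg common x l12; rewrite vE.
  have kE : k = l1 + 2 by case: k_sub2 => ->; rewrite ?l12.
  by move=> /(count_arith_equal kE); rewrite v_mul => /(mul_neq7 m_gt1 n_gt1).
have [R [RE R_sym]] := quotient_matrix G_reg card_class common n_gt0 l12.
have [l12_lt | l21_lt] : l1 < l2 \/ l2 < l1 by lia.
  have kE : k = l2 + 2 by lia.
  have [[n2 l10 l22 k4 I4] R1] :=
    l2_max_parameters G_reg card_class common n_gt0 RE R_sym kE l12_lt n_gt1 I_gt1.
  constructor 3; split; first by rewrite v_mul -card_I I4 n2 l10 l22 k4.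
  exact: (isomorphic_grid G_reg card_class common n_gt0 RE).
have kE : k = l1 + 2 by lia.
have [r [[r34 n7 kr l20 I2] iso]] :=
  l1_max_parameters G_reg card_class common n_gt0 RE R_sym kE n_gt1 I_gt1 G_conn.
have vE14 : v = 14 by rewrite v_mul -card_I I2 n7.
have m2 : m = 2 by rewrite -card_I.
case: r34 => rE; rewrite rE in kr iso.
  have l1E : l1 = 1 by lia.
  by constructor 2; split=> //; rewrite vE14 kr l1E l20 m2 n7.
have l1E : l1 = 2 by lia.
by constructor 1; split=> //; rewrite vE14 kr l1E l20 m2 n7.
Qed.
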